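(* Let $A$ be an integral domain and let $\star$ be a semifinite semistar operation on $A$. Then $\widetilde\star=s_{\mathrm{Ad}^{\mathrm i}(\mathrm{QSpec}^\star(A))}$.
   Context: Let $A$ be an integral domain with quotient field $K$, and let $\overline{\mathbf F}(A)$ be the set of all nonzero $A$-submodules of $K$. A semistar operation on $A$ is a map $\star:\overline{\mathbf F}(A)\to\overline{\mathbf F}(A)$, $F\mapsto F^\star$, such that for all nonzero $k\in K$ and all $F,G\in\overline{\mathbf F}(A)$: $(kF)^\star=kF^\star$; $F\subseteq G$ implies $F^\star\subseteq G^\star$; $F\subseteq F^\star$; $(F^\star)^\star=F^\star$. An integral ideal $\mathfrak a$ of $A$ is a quasi-$\star$-ideal if either $\mathfrak a=(0)$ or $\mathfrak a^\star\cap A=\mathfrak a$. $\mathrm{QSpec}^\star(A)$ is the set of all prime ideals of $A$ that are quasi-$\star$-ideals (the quasi-$\star$-prime ideals). $\star$ is semifinite (or quasi-spectral) if every proper quasi-$\star$-ideal of $A$ is contained in some quasi-$\star$-prime ideal. For a nonempty $Y\subseteq\mathrm{Spec}(A)$, $s_Y$ is the semistar operation $F\mapsto F^{s_Y}:=\bigcap_{\mathfrak p\in Y}FA_{\mathfrak p}$. The stable closure $\widetilde\star$ of $\star$ is the semistar operation defined by $F^{\widetilde\star}:=\bigcup\{(F:\mathfrak a):\mathfrak a\text{ a nonzero finitely generated ideal of }A\text{ with }\mathfrak a^\star=A^\star\}$, where $(F:\mathfrak a):=\{x\in K:x\mathfrak a\subseteq F\}$. The inverse topology on $\mathrm{Spec}(A)$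 is the topology having as a basis of closed sets the collection of all subsets of $\mathrm{Spec}(A)$ that are open and compact in the Zariski topology (compact: every open cover has a finite subcover). $\mathrm{Ad}^{\mathrm i}(Y)$ denotes the closure of $Y$ in the inverse topology. *)

(* Defs.v *)
From HB Require Import structures.
From mathcomp Require Import all_boot all_algebra.
From mathcomp Require Import ring_quotient.
From mathcomp Require Import mathcomp_extra boolp classical_sets topology.

Set Implicit Arguments.
Unset Strict Implicit.
Unset Printing Implicit Defensive.

Import GRing.Theory.
Local Open Scope classical_set_scope.
Local Open Scope ring_scope.

Notation "x %:F" := (FracField.tofrac x) : ring_scope.

(* Lets [F x] be written for membership in the set underlying a record [F]. *)
Identity Coercion set_Funclass : set >-> Funclass.

(* Ideals need not be proper; [A^o] is [A] as a module over itself. *)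
Record ideal (A : idomainType) := Ideal {
  ideal_set :> set A;
  ideal_closed : GRing.submod_closed ([in ideal_set] : {pred A^o})
}.

Record Spec (A : idomainType) := PrimeIdeal {
  prime_set :> set A;
  prime_idealr : idealr_closed [in prime_set];
  prime_prime : prime_idealr_closed [in prime_set]
}.

(* Nonzero [A]-submodules of the quotient field. *)
Record Fbar (A : idomainType) := NzSubmodule {
  fbar_set :> set {fraction A};
  fbar_0 : fbar_set 0;
  fbar_add : forall x y, fbar_set x -> fbar_set y -> fbar_set (x + y);
  fbar_mul : forall (a : A) x, fbar_set x -> fbar_set (a%:F * x);
  fbar_nz : exists2 x, fbar_set x & x != 0
}.

Section Ideals.
Variable A : idomainType.
Implicit Types (a b : ideal A) (p : Spec A) (F G : Fbar A).

Lemma idealP a : [/\ a 0, forall x y, a x -> a y -> a (x + y) &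
  forall c x, a x -> a (c * x)].
Proof.
case: a => a /= [a0 aD]; rewrite inE in a0; split=> // [x y ax ay|c x ax].
  by have := aD 1 x y; rewrite !inE scale1r; apply.
by have := aD c x 0; rewrite !inE addr0; apply.
Qed.

Lemma ideal_closedI (I : set A) : I 0 -> (forall x y, I x -> I y -> I (x + y)) ->
  (forall c x, I x -> I (c * x)) -> GRing.submod_closed ([in I] : {pred A^o}).
Proof.
move=> I0 ID IM; split; first by rewrite inE.
by move=> c x y; rewrite !inE => Ix Iy; apply: ID => //; apply: IM.
Qed.

Lemma spec_ideal_closed p : GRing.submod_closed ([in prime_set p] : {pred A^o}).
Proof. by have [p0 _ pD] := prime_idealr p; split. Qed.

Definition ideal_of_prime p : ideal A := Ideal (spec_ideal_closed p).

Lemma specP p : [/\ p 0, ~ p 1 & forall x y, p (x * y) -> p x \/ p y].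
Proof.
have [p0 p1 _] := prime_idealr p; rewrite !inE in p0.
split=> // [p1'|x y pxy]; first by move/negP: p1; apply; rewrite inE.
have := @prime_prime _ p x y; rewrite !inE => /(_ pxy) /orP.
by rewrite !inE.
Qed.

Lemma setT_ideal_closed : GRing.submod_closed ([in [set: A]] : {pred A^o}).
Proof. exact: ideal_closedI. Qed.

Definition unit_ideal : ideal A := Ideal setT_ideal_closed.

Definition is_zero_ideal a : Prop := a = [set 0] :> set A.

Lemma ideal_nzP a : ~ is_zero_ideal a -> exists2 x, a x & x != 0.
Proof.
move=> anz; apply: contrapT => h; apply: anz; apply/seteqP.
have [a0 _ _] := idealP a; split=> [x ax|_ -> //] /=.
by apply: contrapT => /eqP xnz; apply: h; exists x.
Qed.

Lemma ideal_nz a x : a x -> x != 0 -> ~ is_zero_ideal a.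
Proof. by move=> ax xnz e; move: ax; rewrite e => /eqP; rewrite (negbTE xnz). Qed.

Lemma unit_ideal_nz : ~ is_zero_ideal unit_ideal.
Proof. by apply: (@ideal_nz _ 1) => //; rewrite oner_neq0. Qed.

Definition fin_gen a : Prop := exists n (g : 'I_n -> A),
  a = [set x | exists c : 'I_n -> A, x = \sum_(i < n) c i * g i] :> set A.

Lemma fbar_ext F G : F = G :> set _ -> F = G.
Proof.
case: F G => F F1 F2 F3 F4 [G G1 G2 G3 G4] /= e; subst G.
by congr NzSubmodule; apply: Prop_irrelevance.
Qed.

(* A nonzero ideal of [A] as a submodule of the quotient field. *)
Definition fbar_of_ideal a (nz : ~ is_zero_ideal a) : Fbar A.
Proof.
exists [set x%:F | x in a].
- by have [? _ _] := idealP a; exists 0; rewrite ?rmorph0.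
- have [_ aD _] := idealP a.
  by move=> _ _ [x ax <-] [y ay <-]; exists (x + y); [exact: aD|rewrite rmorphD].
- have [_ _ aM] := idealP a.
  by move=> c _ [x ax <-]; exists (c * x); [exact: aM|rewrite rmorphM].
- have [x ax xnz] := ideal_nzP nz.
  by exists x%:F; [exists x|rewrite tofrac_eq0].
Defined.

Definition fbar_unit : Fbar A := fbar_of_ideal unit_ideal_nz.

Definition fbar_scale (k : {fraction A}) (kn0 : k != 0) F : Fbar A.
Proof.
exists [set k * x | x in F].
- by exists 0; rewrite ?mulr0 //; exact: fbar_0.
- move=> _ _ [x Fx <-] [y Fy <-]; exists (x + y); last by rewrite mulrDr.
  exact: fbar_add.
- move=> c _ [x Fx <-]; exists (c%:F * x); last by rewrite mulrCA.
  exact: fbar_mul.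
- have [x Fx xnz] := fbar_nz F.
  by exists (k * x); [exists x|rewrite mulf_neq0].
Defined.

End Ideals.

Record semistar (A : idomainType) := Semistar {
  star :> Fbar A -> Fbar A;
  star_scale : forall (k : {fraction A}) (kn0 : k != 0) F,
    star (fbar_scale kn0 F) = fbar_scale kn0 (star F);
  star_mono : forall F G : Fbar A, F `<=` G -> star F `<=` star G;
  star_ext : forall F : Fbar A, F `<=` star F;
  star_idem : forall F : Fbar A, star (star F) = star F
}.

Section QuasiStar.
Variables (A : idomainType) (s : semistar A).

Definition quasi_star_ideal (a : ideal A) : Prop :=
  is_zero_ideal a \/
  exists nz : ~ is_zero_ideal a, [set x | s (fbar_of_ideal nz) x%:F] = a.

Definition QSpec : set (Spec A) :=
  [set p | quasi_star_ideal (ideal_of_prime p)].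

Definition semifinite : Prop := forall a : ideal A,
  quasi_star_ideal a -> a <> [set: A] :> set A ->
  exists2 p, QSpec p & a `<=` p.

End QuasiStar.

Section Spectral.
Variable A : idomainType.
Local Notation K := {fraction A}.

Definition localization (p : Spec A) : set K :=
  [set x | exists a s : A, ~ p s /\ x = a%:F / s%:F].

(* Finite sums of products. *)
Definition set_prod (F G : set K) : set K :=
  [set x | exists n (f g : 'I_n -> K),
    [/\ forall i, F (f i), forall i, G (g i) & x = \sum_(i < n) f i * g i]].

Lemma tofrac_prime_neq0 (p : Spec A) s : ~ p s -> s%:F != 0 :> K.
Proof.
by move=> ps; rewrite tofrac_eq0; apply/eqP => s0; apply: ps; rewrite s0; case: (specP p).
Qed.

Lemma set_prod_locP (F : Fbar A) (p : Spec A) x :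
  set_prod F (localization p) x <-> exists2 s, ~ p s & F (x * s%:F).
Proof.
have [p0 p1 pM] := specP p; split=> [[n [f [g [Ff Gg ->]]]]|[s ps Fx]].
  elim/big_ind: _ => [|y z [s ps Fs] [t pt Ft]|i _].
  - by exists 1 => //; rewrite mul0r; exact: fbar_0.
  - exists (s * t); first by case/pM.
    rewrite rmorphM mulrDl; apply: fbar_add.
      by rewrite mulrA mulrC; apply: fbar_mul.
    by rewrite [s%:F * _]mulrC mulrA mulrC; apply: fbar_mul.
  - have [a [s [ps ->]]] := Gg i; exists s => //.
    rewrite mulrA mulfVK ?(tofrac_prime_neq0 ps) // mulrC.
    exact: fbar_mul.
exists 1%N, (fun=> x * s%:F), (fun=> 1%:F / s%:F); split=> //.
  by move=> _; exists 1, s.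
by rewrite big_ord1 rmorph1 mul1r mulfK // (tofrac_prime_neq0 ps).
Qed.

Definition spectral_fbar (Y : set (Spec A)) (F : Fbar A) : Fbar A.
Proof.
exists (\bigcap_(p in Y) set_prod F (localization p)).
- move=> p _; apply/set_prod_locP; exists 1; first by case: (specP p).
  by rewrite mul0r; exact: fbar_0.
- move=> x y hx hy p Yp; apply/set_prod_locP.
  have [s ps Fs] := (set_prod_locP _ _ _).1 (hx p Yp).
  have [t pt Ft] := (set_prod_locP _ _ _).1 (hy p Yp).
  have [_ _ pM] := specP p; exists (s * t); first by case/pM.
  rewrite rmorphM mulrDl; apply: fbar_add.
    by rewrite mulrA mulrC; apply: fbar_mul.
  by rewrite [s%:F * _]mulrC mulrA mulrC; apply: fbar_mul.
- move=> a x hx p Yp; apply/set_prod_locP.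
  have [s ps Fs] := (set_prod_locP _ _ _).1 (hx p Yp).
  by exists s => //; rewrite -mulrA; apply: fbar_mul.
- have [x Fx xnz] := fbar_nz F; exists x => // p _.
  apply/set_prod_locP; exists 1; first by case: (specP p).
  by rewrite rmorph1 mulr1.
Defined.

Lemma spectral_fbarP Y F x : spectral_fbar Y F x <->
  forall p, Y p -> exists2 s, ~ p s & F (x * s%:F).
Proof.
by split=> h p Yp; apply/set_prod_locP; apply: h.
Qed.

(* For empty [Y] this is the semistar operation constantly equal to the
   quotient field. *)
Definition spectral (Y : set (Spec A)) : semistar A.
Proof.
exists (spectral_fbar Y).
- move=> k kn0 F; apply: fbar_ext; apply/seteqP; split=> x.
    move/spectral_fbarP=> h; exists (k^-1 * x); last by rewrite mulVKf.
    apply/spectral_fbarP => p /h [s ps [y Fy e]]; exists s => //.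
    by rewrite -mulrA -e mulKf.
  case=> y /spectral_fbarP h <-; apply/spectral_fbarP => p /h [s ps Fs].
  by exists s => //; exists (y * s%:F) => //; rewrite mulrA.
- move=> F G FG x /spectral_fbarP h; apply/spectral_fbarP => p /h [s ps /FG].
  by exists s.
- move=> F x Fx; apply/spectral_fbarP => p _; exists 1; first by case: (specP p).
  by rewrite rmorph1 mulr1.
- move=> F; apply: fbar_ext; apply/seteqP; split=> x.
    move/spectral_fbarP => h; apply/spectral_fbarP => p Yp.
    have [s ps /spectral_fbarP /(_ p Yp) [t pt Ft]] := h p Yp.
    have [_ _ pM] := specP p; exists (s * t); first by case/pM.
    by rewrite rmorphM mulrA.
  move=> h; apply/spectral_fbarP => p _; exists 1; first by case: (specP p).
  by rewrite rmorph1 mulr1.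
Defined.

End Spectral.

Section Stable.
Variables (A : idomainType) (s : semistar A).
Local Notation K := {fraction A}.
Implicit Types (a b : ideal A) (F : Fbar A).

Definition colon (F : Fbar A) (a : ideal A) : set K :=
  [set x | forall y, a y -> F (x * y%:F)].

Definition stable_ideals : set (ideal A) :=
  [set a | fin_gen a /\
    exists nz : ~ is_zero_ideal a, s (fbar_of_ideal nz) = s (fbar_unit A)].

Lemma stable_unit : stable_ideals (unit_ideal A).
Proof.
split; last by exists (@unit_ideal_nz A).
exists 1%N, (fun=> 1); apply/seteqP; split=> // x _; exists (fun=> x).
by rewrite big_ord1 mulr1.
Qed.

Section Gen.
Variables (I : finType) (g : I -> A).
Definition gen_set : set A := [set x | exists c : I -> A, x = \sum_i c i * g i].
Lemma gen_closed : GRing.submod_closed ([in gen_set] : {pred A^o}).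
Proof.
apply: ideal_closedI.
- by exists (fun=> 0); rewrite big1 // => i _; rewrite mul0r.
- move=> _ _ [c ->] [d ->]; exists (fun i => c i + d i).
  by rewrite -big_split; apply: eq_bigr => i _; rewrite mulrDl.
- move=> b _ [c ->]; exists (fun i => b * c i).
  by rewrite mulr_sumr; apply: eq_bigr => i _; rewrite mulrA.
Qed.
Definition gen : ideal A := Ideal gen_closed.
Lemma gen_mem i : gen (g i).
Proof.
exists (fun j => (j == i)%:R); rewrite (bigD1 i) //= eqxx mul1r big1 ?addr0 //.
by move=> j /negbTE ->; rewrite mul0r.
Qed.
Lemma gen_sub b : (forall i, b (g i)) -> gen `<=` b.
Proof.
have [b0 bD bM] := idealP b => h _ [c ->].
by elim/big_ind: _ => // i _; apply: bM.
Qed.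
Lemma gen_fin : fin_gen gen.
Proof.
have E (f : I -> A) : \sum_i f i = \sum_(j < #|I|) f (enum_val j).
  by rewrite (reindex (@enum_val I predT)) //=; apply/onW_bij/enum_val_bij.
exists #|I|, (fun j => g (enum_val j)); apply/seteqP; split=> _ [c ->].
  by exists (fun j => c (enum_val j)); rewrite E.
by exists (fun i => c (enum_rank i)); rewrite E; apply: eq_bigr => j _; rewrite enum_valK.
Qed.
End Gen.

Lemma stable_prod_closed (a b c : ideal A) :
  stable_ideals a -> stable_ideals b -> fin_gen c ->
  (forall x y, a x -> b y -> c (x * y)) -> stable_ideals c.
Proof.
move=> [_ [anz ea]] [_ [bnz eb]] cf abc.
have [x ax xn0] := ideal_nzP anz; have [y by_ yn0] := ideal_nzP bnz.
have cnz : ~ is_zero_ideal c.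
  by apply: (ideal_nz (abc _ _ ax by_)); rewrite mulf_neq0.
split=> //; exists cnz; apply: fbar_ext; apply/seteqP; split.
  by apply: star_mono => _ [z _ <-]; exists z.
rewrite -ea -[s (fbar_of_ideal cnz)]star_idem; apply: star_mono => _ [z az <-].
have [->|zn0] := eqVneq z 0; first by rewrite rmorph0; exact: fbar_0.
have zFn0 : z%:F != 0 :> K by rewrite tofrac_eq0.
have sub : fbar_scale zFn0 (fbar_of_ideal bnz) `<=` fbar_of_ideal cnz.
  by move=> _ [_ [w bw <-] <-]; exists (z * w); [exact: abc|rewrite rmorphM].
apply: (star_mono sub); rewrite star_scale eb; exists 1; last by rewrite mulr1.
by apply: star_ext; exists 1; rewrite ?rmorph1.
Qed.

Lemma fin_genP a : fin_gen a -> exists n (g : 'I_n -> A), a = gen g :> set A.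
Proof. by move=> [n [g e]]; exists n, g. Qed.

Lemma stable_prod a b : stable_ideals a -> stable_ideals b ->
  exists c, [/\ stable_ideals c, c `<=` a & c `<=` b].
Proof.
move=> ha hb; have [n [g eg]] := fin_genP ha.1; have [m [h eh]] := fin_genP hb.1.
pose f (ij : 'I_n * 'I_m) := g ij.1 * h ij.2.
have [_ _ aM] := idealP a; have [_ _ bM] := idealP b.
exists (gen f); split.
- apply: (stable_prod_closed ha hb (gen_fin f)) => x y.
  rewrite eg eh => -[c ->] [d ->]; exists (fun ij => c ij.1 * d ij.2).
  rewrite big_distrlr /= pair_big; apply: eq_bigr => -[i j] _ /=.
  by rewrite /f /= mulrACA.
- by apply: gen_sub => i; rewrite /f mulrC; apply: aM; rewrite eg; exact: gen_mem.
- by apply: gen_sub => i; apply: bM; rewrite eh; exact: gen_mem.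
Qed.

Definition stable_fbar (F : Fbar A) : Fbar A.
Proof.
exists (\bigcup_(a in stable_ideals) colon F a).
- exists (unit_ideal A); first exact: stable_unit.
  by move=> y _; rewrite mul0r; exact: fbar_0.
- move=> x y [a ha hx] [b hb hy]; have [c [hc ca cb]] := stable_prod ha hb.
  exists c => // z cz; rewrite mulrDl; apply: fbar_add.
    by apply: hx; exact: ca.
  by apply: hy; exact: cb.
- move=> d x [a ha hx]; exists a => // z az; rewrite -mulrA.
  by apply: fbar_mul; exact: hx.
- have [x Fx xnz] := fbar_nz F; exists x => //; exists (unit_ideal A).
    exact: stable_unit.
  by move=> y _; rewrite mulrC; apply: fbar_mul.
Defined.

Lemma stable_fbar_ext F : F `<=` stable_fbar F.
Proof.
move=> x Fx; exists (unit_ideal A); first exact: stable_unit.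
by move=> y _; rewrite mulrC; apply: fbar_mul.
Qed.

Lemma stable_fbar_fin F n (g : 'I_n -> A) x :
  (forall i, stable_fbar F (x * (g i)%:F)) ->
  exists2 b, stable_ideals b & forall i y, b y -> F (x * (g i)%:F * y%:F).
Proof.
elim: n g => [|n IH] g h.
  by exists (unit_ideal A); [exact: stable_unit|case].
have [b hb Hb] := IH (fun i => g (lift ord0 i)) (fun i => h _).
have [a ha Ha] := h ord0; have [c [hc ca cb]] := stable_prod ha hb.
exists c => // i y cy; case: (unliftP ord0 i) => [j|] ->.
  by apply: Hb; exact: cb.
by apply: Ha; exact: ca.
Qed.

Definition stable_closure : semistar A.
Proof.
exists stable_fbar.
- move=> k kn0 F; apply: fbar_ext; apply/seteqP; split=> x.
    move=> [a ha h]; exists (k^-1 * x); last by rewrite mulVKf.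
    exists a => // y /h [z Fz e]; by rewrite -mulrA -e mulKf.
  case=> y [a ha h] <-; exists a => // z az.
  by exists (y * z%:F); [exact: h|rewrite mulrA].
- by move=> F G FG x [a ha h]; exists a => // y /h /FG.
- exact: stable_fbar_ext.
- move=> F; apply: fbar_ext; apply/seteqP; split; last exact: stable_fbar_ext.
  move=> x [a ha h]; have [n [g eg]] := fin_genP ha.1.
  have [b hb Hb] := @stable_fbar_fin F n g x (fun i => h _ (eq_ind_r (fun S : set A => S (g i)) (gen_mem g i) eg)).
  have [m [k ek]] := fin_genP hb.1.
  pose u (ij : 'I_n * 'I_m) := g ij.1 * k ij.2.
  exists (gen u).
    apply: (stable_prod_closed ha hb (gen_fin u)) => y z.
    rewrite eg ek => -[c ->] [d ->]; exists (fun ij => c ij.1 * d ij.2).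
    rewrite big_distrlr /= pair_big; apply: eq_bigr => -[i j] _ /=.
    by rewrite /u /= mulrACA.
  move=> _ [c ->]; rewrite rmorph_sum mulr_sumr.
  elim/big_ind: _ => [|y z|[i j] _]; [exact: fbar_0|exact: fbar_add|].
  rewrite !rmorphM mulrCA mulrA /=; rewrite -mulrA; apply: fbar_mul.
  by rewrite mulrA; apply: Hb; rewrite ek; exact: gen_mem.
Defined.

End Stable.

HB.instance Definition _ (A : idomainType) := gen_eqMixin (Spec A).
HB.instance Definition _ (A : idomainType) := gen_choiceMixin (Spec A).

Section Zariski.
Variable A : idomainType.

Lemma zero_idealr : idealr_closed [in [set 0 : A]].
Proof.
split; first by rewrite inE.
  by apply/negP; rewrite inE /= => /eqP; rewrite oner_eq0.
by move=> a x y; rewrite !inE /= => -> ->; rewrite mulr0 addr0.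
Qed.

Lemma zero_prime : prime_idealr_closed [in [set 0 : A]].
Proof.
move=> x y; rewrite !inE /= => /eqP; rewrite mulf_eq0.
by case/orP => /eqP ->; apply/orP; [left|right]; rewrite inE.
Qed.

(* A point is what the library needs for [compact = cover_compact]. *)
HB.instance Definition _ := isPointed.Build (Spec A)
  (PrimeIdeal zero_idealr zero_prime).

Definition zero_locus (S : set A) : set (Spec A) := [set p | S `<=` p].

Definition zariski_open : set (set (Spec A)) := range (fun S => ~` zero_locus S).

Lemma zariski_openT : zariski_open setT.
Proof.
exists setT => //; rewrite -[RHS]setC0; apply: (congr1 setC); apply/seteqP; split=> // p pT.
by case: (specP p) => _ p1 _; apply: p1; apply: pT.
Qed.

Lemma zariski_openI : setI_closed zariski_open.
Proof.
move=> _ _ [S _ <-] [T _ <-]; exists [set x * y | x in S & y in T] => //.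
rewrite -setCU; apply: (congr1 setC); apply/seteqP; split=> p; last first.
  have [_ _ pM] := idealP (ideal_of_prime p).
  by case=> h _ [x Sx [y Ty <-]]; [rewrite mulrC|]; apply: pM; exact: h.
move=> h; apply: contrapT => /not_orP [/existsNP [x /not_implyP [Sx px]]].
move=> /existsNP [y /not_implyP [Ty py]].
have [_ _ pP] := specP p.
by case: (pP x y (h _ (ex_intro2 _ _ x Sx (ex_intro2 _ _ y Ty erefl)))).
Qed.

Lemma zariski_open_bigU (J : Type) (f : J -> set (Spec A)) :
  (forall i, zariski_open (f i)) -> zariski_open (\bigcup_i f i).
Proof.
move=> /(_ _) /cid2-/all_sig2 [S _ hS]; exists (\bigcup_i S i) => //.
rewrite -[RHS]setCK setC_bigcup; apply: (congr1 setC); apply/seteqP; split=> p h.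
  by move=> i _; rewrite -hS setCK => x Sx; apply: h; exists i.
by move=> x [i _ Sx]; have := h i I; rewrite -hS setCK; exact.
Qed.

HB.instance Definition _ := isOpenTopological.Build (Spec A)
  zariski_openT zariski_openI zariski_open_bigU.

End Zariski.

(* An alias of [Spec A] carrying the inverse topology. *)
Definition inverse_spec (A : idomainType) : Type := Spec A.

HB.instance Definition _ (A : idomainType) :=
  Pointed.copy (inverse_spec A) (Spec A).

Section Inverse.
Variable A : idomainType.

Definition open_compact : set (set (Spec A)) :=
  [set U | open U /\ cover_compact U].

(* Bases of open sets are complements of bases of closed sets. *)
Definition inverse_base (U : set (Spec A)) : set (inverse_spec A) := ~` U.

Lemma inverse_base_cover : \bigcup_(U in open_compact) inverse_base U = setT.
Proof.
apply/seteqP; split=> // p _; exists set0 => //; split; first exact: open0.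
by rewrite -compact_cover; exact: compact0.
Qed.

Lemma inverse_base_join U V p : open_compact U -> open_compact V ->
  inverse_base U p -> inverse_base V p ->
  exists W, [/\ open_compact W, inverse_base W p &
    inverse_base W `<=` inverse_base U `&` inverse_base V].
Proof.
rewrite /open_compact -compact_cover => -[oU cU] [oV cV] Up Vp; exists (U `|` V).
rewrite /inverse_base setCU; split=> //; split; first exact: openU.
exact: compactU.
Qed.

HB.instance Definition _ := isBaseTopological.Build (inverse_spec A)
  inverse_base_cover inverse_base_join.

End Inverse.

Definition Ad_inv (A : idomainType) (Y : set (Spec A)) : set (Spec A) :=
  closure (Y : set (inverse_spec A)).

(* Main.v *)
Require Import Defs.
From mathcomp Require Import all_boot all_algebra.
From mathcomp Require Import ring_quotient boolp classical_sets topology.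

Set Implicit Arguments.
Unset Strict Implicit.
Unset Printing Implicit Defensive.

Import GRing.Theory.
Local Open Scope classical_set_scope.
Local Open Scope ring_scope.

(** Two facts combine.

    (i) A nonzero finitely generated ideal [a] satisfies [a^star = A^star] iff
    no quasi-star-prime contains it.  If [a^star = A^star] and [a] is inside such
    a [p], then [1 \in A^star = a^star] is in [p^star], hence in [p], which is
    absurd.  If [a^star] is not [A^star], then [a^star] meets [A] in a proper
    quasi-star-ideal, and semifiniteness puts it inside a quasi-star-prime
    ([stable_not_sub_QSpec], [sub_QSpec]).

    (ii) A prime lies in the inverse closure of [Y] iff it lies in every compact
    open set that contains [Y] ([Ad_invP]), and the primes not containing a
    finitely generated ideal form a compact open set ([open_compact_fin_gen]).

    Let [x a <= F] with [a] finitely generated, nonzero and [a^star = A^star].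
    All quasi-star-primes lie in the compact open complement of [V(a)], hence so
    do all primes [p] of the inverse closure, and an element of [a] outside [p]
    shows that [x] is in [F A_p].

    Conversely, let [x] be outside [F^~], and let [I] be the ideal of the
    [y \in A] with [x y \in F].  By (i), each finitely generated ideal inside
    [I] lies in some quasi-star-prime (the zero ideal in the zero prime).  The
    step from finitely generated ideals to [I] is a compactness argument: a
    single prime of the inverse closure contains [I] ([Ad_inv_ultra]), and at
    that prime [x] is not in [F A_p].

    Both compactness arguments rest on one construction.  An ultrafilter [U] on
    the spectrum has the limit prime [{x | x \in p for U-almost all p}].  It is a
    limit of [U] for the Zariski topology, and it belongs to every [U]-large
    compact open set, so it is a limit for the inverse topology as well. *)

(** * Ultrafilters of primes and compact open sets *)

Section UltrafilterLimit.
Variables (A : idomainType) (U : set_system (Spec A)) (UU : UltraFilter U).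

Definition ultra_limit_set : set A := [set x | U [set p | p x]].

Lemma ultra_limit_idealr : idealr_closed [in ultra_limit_set].
Proof.
split.
- rewrite inE /ultra_limit_set /=; apply: filterS filterT => p _ /=.
  by case: (specP p).
- apply/negP; rewrite inE /ultra_limit_set /= => h.
  by apply: (filter_not_empty U); apply: filterS h => p /=; case: (specP p).
- move=> a x y; rewrite !inE /ultra_limit_set /= => hx hy.
  apply: filterS (filterI hx hy) => p [/= px py].
  by have [_ pD pM] := idealP (ideal_of_prime p); apply: pD => //; apply: pM.
Qed.

Lemma ultra_limit_prime : prime_idealr_closed [in ultra_limit_set].
Proof.
move=> x y; rewrite inE /ultra_limit_set /= => hxy; apply/orP.
have [hx|nx] := in_ultra_setVsetC [set p : Spec A | p x] UU.
  by left; rewrite inE.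
right; rewrite inE /ultra_limit_set /=.
apply: filterS (filterI hxy nx) => p [/= pxy npx].
by have [_ _ /(_ _ _ pxy) []] := specP p.
Qed.

Definition ultra_limit : Spec A :=
  PrimeIdeal ultra_limit_idealr ultra_limit_prime.

Lemma ultra_limitN x : ~ ultra_limit x -> U [set p | ~ p x].
Proof. by have [hx|] := in_ultra_setVsetC [set p : Spec A | p x] UU. Qed.

End UltrafilterLimit.

Lemma open_basic (A : idomainType) (x : A) : open [set p : Spec A | ~ p x].
Proof.
exists [set x] => //; apply: (congr1 setC); apply/seteqP.
by split=> p; [apply | move=> px _ ->].
Qed.

(** By definition of the limit prime, an [x] outside it is outside almost all
    primes, and such [x] give a neighbourhood basis of basic open sets. *)
Lemma ultra_limit_cvg (A : idomainType) (U : set_system (Spec A))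
  (UU : UltraFilter U) : U --> ultra_limit UU.
Proof.
move=> B; rewrite nbhsE => -[_ [[S _ <-] /existsNP[x /not_implyP[Sx nx]]]].
by move=> /filterS; apply; apply: filterS (ultra_limitN nx) => p /= px /(_ _ Sx).
Qed.

(** Some limit [q] of [U] lies in [D] by compactness.  If [D] is the complement
    of [V(S)] and the limit prime contained [S], then each [x] in [S] would lie in
    almost all primes, whereas an [x] in [S] outside [q] avoids almost all. *)
Lemma ultra_limit_open_compact (A : idomainType) (U : set_system (Spec A))
  (UU : UltraFilter U) (D : set (Spec A)) :
  open_compact D -> U D -> D (ultra_limit UU).
Proof.
rewrite /open_compact -compact_cover compact_ultra => -[[S _ <-] cD] UD.
have [q [/existsNP[x /not_implyP[Sx qx]] Uq]] := cD U UU UD => hS.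
have Ux : U [set p : Spec A | ~ p x].
  by apply: Uq; apply: open_nbhs_nbhs; split=> //; exact: open_basic.
apply: (filter_not_empty U); apply: filterS (filterI Ux (hS x Sx)).
by move=> p [].
Qed.

(** An ultrafilter that contains the complement of [V(a)] has its limit prime
    there: otherwise each of the finitely many generators of [a] would lie in
    almost all primes, hence so would all of them together.  Finite generation is
    what allows intersecting these large sets. *)
Lemma open_compact_fin_gen (A : idomainType) (a : ideal A) :
  fin_gen a -> open_compact (~` zero_locus a).
Proof.
move=> /fin_genP[n [g ea]]; split; first by exists a.
rewrite -compact_cover compact_ultra => U UU Ua.
exists (ultra_limit UU); split; last exact: ultra_limit_cvg.
move=> h; apply: (filter_not_empty U).
have Ug : U [set p : Spec A | forall i, p (g i)].
  apply: (@filter_forall _ 'I_n (fun i (p : Spec A) => p (g i))) => i.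
  by apply: h; rewrite ea; exact: gen_mem.
apply: filterS (filterI Ua Ug) => p [/= pa pg]; apply: pa => x.
by rewrite ea; apply: (@gen_sub _ _ g (ideal_of_prime p)).
Qed.

Lemma Ad_invP (A : idomainType) (Y : set (Spec A)) p :
  Ad_inv Y p <-> forall D, open_compact D -> Y `<=` D -> D p.
Proof.
split=> [cp D oD YD|h B].
  apply: contrapT => nDp.
  have /cp [q [/YD Dq nDq]] // : nbhs (p : inverse_spec A) (inverse_base D).
  apply: open_nbhs_nbhs; split=> //.
  by exists [set D]; [move=> _ -> | rewrite bigcup_set1].
rewrite nbhsE => -[_ [[Ds Dsoc <-] [D DsD nDp]] sB].
apply: contrapT => nYB; apply: nDp; apply: h; first exact: Dsoc.
move=> q Yq; apply: contrapT => nDq; apply: nYB; exists q; split=> //.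
by apply: sB; exists D.
Qed.

(** The sets [Y :&: V(g)], for finite families [g] in [I], generate a proper
    filter, and the limit prime of any ultrafilter refining it is as required.
    Every compact open set containing [Y] is large, so the limit is in the
    inverse closure although it need not be in [Y]. *)
Lemma Ad_inv_ultra (A : idomainType) (Y : set (Spec A)) (I : set A) :
  (forall n (g : 'I_n -> A), (forall i, I (g i)) ->
     exists2 p, Y p & forall i, p (g i)) ->
  exists2 p, Ad_inv Y p & I `<=` p.
Proof.
move=> fip.
pose E := [set xs : seq A | forall x, x \in xs -> I x].
pose B (xs : seq A) := Y `&` [set p | forall x, x \in xs -> p x].
have BF : ProperFilter (filter_from E B).
  apply: filter_from_proper => [|xs Exs].
    apply: filter_from_filter; first by exists [::].
    move=> xs ys Exs Eys; exists (xs ++ ys).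
      by move=> x; rewrite mem_cat => /orP[/Exs|/Eys].
    move=> p [Yp h]; split; split=> // x hx; apply: h.
      by rewrite mem_cat hx.
    by rewrite mem_cat hx orbT.
  have [|p Yp h] := fip (size xs) (tnth (in_tuple xs)).
    by move=> i; apply: Exs; apply: mem_tnth.
  by exists p; split=> // x /(tnthP (in_tuple xs))[i ->].
have [U [UU sU]] := ultraFilterLemma BF.
exists (ultra_limit UU).
  apply/Ad_invP => D oD YD; apply: ultra_limit_open_compact => //.
  by apply: sU; exists [::] => // p [/YD].
move=> x Ix; apply: sU; exists [:: x].
  by move=> y; rewrite inE => /eqP ->.
by move=> p [_]; apply; rewrite inE.
Qed.

(** * Quasi-star-primes and stable ideals *)

Lemma semistar_ext (A : idomainType) (s t : semistar A) :
  (forall F, s F = t F :> set _) -> s = t.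
Proof.
case: s t => s s1 s2 s3 s4 [t t1 t2 t3 t4] /= e.
have est : s = t by apply: funext => F; apply: fbar_ext.
by subst t; congr Semistar; apply: Prop_irrelevance.
Qed.

Section QuasiPrimes.
Variables (A : idomainType) (s : semistar A).

Lemma stable_not_sub_QSpec (a : ideal A) p :
  stable_ideals s a -> QSpec s p -> ~ a `<=` p.
Proof.
move=> [_ [anz ea]] Qp ap; have [x ax xn0] := ideal_nzP anz.
case: Qp => [p0|[pnz ep]].
  by have := ap x ax; rewrite [p x](congr1 (@^~ x) p0) => /eqP; rewrite (negbTE xn0).
have [_ p1 _] := specP p; apply: p1.
rewrite -[p 1](congr1 (@^~ 1) ep) /=.
have sub : fbar_of_ideal anz `<=` fbar_of_ideal pnz.
  by move=> _ [y /ap py <-]; exists y.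
by apply: (star_mono sub); rewrite ea; apply: star_ext; exists 1.
Qed.

Lemma quasi_closure_closed (a : ideal A) (nz : ~ is_zero_ideal a) :
  GRing.submod_closed ([in [set x | s (fbar_of_ideal nz) x%:F]] : {pred A^o}).
Proof.
apply: ideal_closedI => [|x y|c x] /=.
- by rewrite rmorph0; apply: fbar_0.
- by rewrite rmorphD; apply: fbar_add.
- by rewrite rmorphM; apply: fbar_mul.
Qed.

(** The prime is given by semifiniteness, applied to the quasi-star-ideal
    [a^star :&: A].  The zero ideal has no star closure, but it lies in
    the zero prime, which is a quasi-star-prime by convention. *)
Lemma sub_QSpec (hs : semifinite s) (a : ideal A) : fin_gen a ->
  ~ stable_ideals s a -> exists2 p, QSpec s p & a `<=` p.
Proof.
move=> fa nst; have [a0|anz] := pselect (is_zero_ideal a).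
  exists (PrimeIdeal (@zero_idealr A) (@zero_prime A)); first by left.
  by rewrite a0.
pose b := Ideal (quasi_closure_closed anz).
have ab : a `<=` b by move=> x ax; apply: star_ext; exists x.
have [x ax xn0] := ideal_nzP anz.
have bnz : ~ is_zero_ideal b by apply: (ideal_nz (ab x ax)).
have qb : quasi_star_ideal s b.
  right; exists bnz; apply/seteqP; split=> y /=; last first.
    by move=> by_; apply: star_ext; exists y.
  rewrite -[s (fbar_of_ideal anz)]star_idem; apply: star_mono.
  by move=> _ [z bz <-].
have [|p Qp bp] := hs b qb; last by exists p => // y /ab /bp.
(* If [b] were the whole ring, then [A] would be inside [a^star]. *)
move=> bT; apply: nst; split=> //; exists anz; apply: fbar_ext.
apply/seteqP; split; first by apply: star_mono => _ [y _ <-]; exists y.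
rewrite -[s (fbar_of_ideal anz)]star_idem; apply: star_mono => _ [y _ <-].
by have : b y by rewrite bT.
Qed.

End QuasiPrimes.

(** * The stable closure *)

Theorem proposition5p8 (A : idomainType) (s : semistar A) (hs : semifinite s) :
  stable_closure s = spectral (Ad_inv (QSpec s)).
Proof.
apply: semistar_ext => F; apply/seteqP; split=> x.
  move=> [a sa ax]; apply/spectral_fbarP => p /Ad_invP hp.
  have pa : ~ a `<=` p.
    apply: (hp _ (open_compact_fin_gen sa.1)) => q.
    exact: stable_not_sub_QSpec.
  apply: contrapT => nF; apply: pa => y ay.
  by apply: contrapT => py; apply: nF; exists y => //; exact: ax.
move=> /spectral_fbarP hx; apply: contrapT => nx.
(* A prime of the closure containing [{y | x y \in F}] contradicts [hx], so it
   remains to put each finite family [g] in this set into a quasi-star-prime. *)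
have [n g Fg|p /hx[y py Fy] /(_ y Fy)//] :=
  @Ad_inv_ultra A (QSpec s) [set y | F (x * y%:F)].
have [|p Qp gp] := @sub_QSpec _ _ hs (gen g) (gen_fin g); last first.
  by exists p => // i; apply: gp; apply: gen_mem.
(* A stable ideal inside [{y | x y \in F}] would put [x] in [F^~]. *)
move=> sg; apply: nx; exists (gen g) => // _ [c ->].
rewrite rmorph_sum mulr_sumr; elim/big_ind: _ => [|u v|i _].
- exact: fbar_0.
- exact: fbar_add.
- by rewrite rmorphM mulrCA; apply: fbar_mul; exact: Fg.
Qed.
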